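(* Let $\mathcal{P}$ be a bilateral parking procedure, and let $W\mapsto\widehat{\mathcal{P}}(W)=(P,Q)$ be the associated $\mathcal{P}$-correspondence. (i) A word $W$ is $\mathcal{P}$-parking if the common shape of $(P,Q)=\widehat{\mathcal{P}}(W)$ is a tree with support of the form $\{1,2,\ldots,r\}$. (ii) The $\mathcal{P}$-correspondence $\widehat{\mathcal{P}}$ is injective on $\mathbb{Z}^*$. (iii) For every word $W$ with $\widehat{\mathcal{P}}(W)=(P,Q)$, the canonical label of a node is equal to the spot where the corresponding car parked: if the node has label $k$ in $Q$, its canonical label is the spot in which the $k$th car parked.
   Context: $\mathbb{Z}^*$ is the set of finite words on $\mathbb{Z}$, $\epsilon$ the empty word, $\mathrm{Fin}(\mathbb{Z})$ the set of finite subsets of $\mathbb{Z}$. A parking procedure is a function $\mathcal{P}:\mathbb{Z}^*\to\mathrm{Fin}(\mathbb{Z})$ with $\mathcal{P}(\epsilon)=\emptyset$ such that for every word $a_1\cdots a_r$ with $r\ge1$: (1) $\#\mathcal{P}(a_1\cdots a_r)=r$ and $\mathcal{P}(a_1\cdots a_i)\subset\mathcal{P}(a_1\cdots a_{i+1})$ for $i<r$; (2) if $a_r\notin\mathcal{P}(a_1\cdots a_{r-1})$ then $\mathcal{P}(a_1\cdots a_r)=\mathcal{P}(a_1\cdots a_{r-1})\sqcup\{a_r\}$. The spot where the $i$th car parks is $\mathrm{ls}_{\mathcal{P}}(a_1\cdots a_i)$, the unique element of $\mathcal{P}(a_1\cdots a_i)\setminus\mathcal{P}(a_1\cdots a_{i-1})$.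 A block of $S\subset\mathbb{Z}$ is a maximal nonempty interval of consecutive integers contained in $S$. $\mathcal{P}$ is bilateral if whenever $a\in\mathcal{P}(W)$ lies in the block $\{t,\ldots,u\}$ of $\mathcal{P}(W)$, $\mathrm{ls}_{\mathcal{P}}(Wa)\in\{t-1,u+1\}$. A word $W$ of length $r$ is $\mathcal{P}$-parking if $\mathcal{P}(W)=\{1,\ldots,r\}$. The outcome function $\pi_{\mathcal{P}}(W)$ of $W=a_1\cdots a_r$ is the bijection $\mathcal{P}(W)\to\{1,\ldots,r\}$ sending an occupied spot $k$ to the index $i$ such that the $i$th car parked in $k$, i.e. $\mathrm{ls}_{\mathcal{P}}(a_1\cdots a_i)=k$. A (plane) binary tree is either empty or a node with a left and a right binary subtree; its size is its number of nodes. An indexed forest is the data of a finite set $S\subset\mathbb{Z}$ (its support) and, for each block $I$ of $S$, a binary tree of size $|I|$. Its canonical labeling labels, for each block $I$, the nodes of the corresponding tree by the elements of $I$ increasingly in in-order (left subtree, root, right subtree); nodes are thereby identified with elements of $S$. Binary trees of size $r$ are identified with indexed forests with support $\{1,\ldots,r\}$. A decreasing forest is an indexed forest with $r$ nodes labeled bijectively by $\{1,\ldots,r\}$ so that each node has a larger label than all its descendants. Given $W=a_1\cdots a_r$, $\widehat{\mathcal{P}}(W)=(P,Q)$ is the pair of labeled indexed forests of the same shape $F$ defined as follows. The forest $Q$ is the unique decreasing forest with support $\mathcal{P}(W)$ whose node with canonical label $i$ has label $q_i=\pi_{\mathcal{P}}(W)(i)$ (on each block, this is the decreasing binary tree of the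 corresponding sequence of distinct values: the root is the position of the maximum, and the left and right subtrees are constructed recursively from the positions to the left and to the right). $F$ is its underlying indexed forest, and $P$ is $F$ with node $i$ labeled by $p_i=a_{q_i}$. *)

(* Defs.v *)
From mathcomp Require Import all_boot all_order all_algebra.
From mathcomp Require Import finmap.
Set Implicit Arguments.
Unset Strict Implicit.
Unset Printing Implicit Defensive.
Import Order.TTheory GRing.Theory Num.Theory.
Local Open Scope fset_scope.
Local Open Scope ring_scope.

(* The integer interval {t, ..., u}; it is empty when u < t. *)
Definition zint (t u : int) : {fset int} :=
  if t <= u then [fset t + i%:Z | i in iota 0 `|u - t|%N.+1] else fset0.

Lemma in_zint (t u k : int) : (k \in zint t u) = (t <= k <= u).
Proof.
rewrite /zint; case: (leP t u) => tu; last first.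
  by rewrite inE; apply/esym/negbTE/negP => /andP[tk /(le_trans tk)]; rewrite leNgt tu.
apply/imfsetP/idP => [[i + ->]|/andP[tk ku]].
  rewrite (mem_iota 0 _ i) add0n leq0n ltnS -lez_nat gez0_abs ?subr_ge0 //.
  by move=> iut; rewrite lerDl lez_nat leq0n /= -lerBrDl.
exists `|k - t|%N; last by rewrite /= gez0_abs ?subr_ge0 // [RHS]addrC subrK.
rewrite (mem_iota 0) add0n leq0n ltnS -lez_nat !gez0_abs ?subr_ge0 //.
by rewrite lerD2r.
Qed.

Definition is_interval (I : {fset int}) : bool :=
  [forall i : I, forall j : I, zint (val i) (val j) `<=` I].

Definition is_block (S I : {fset int}) : bool :=
  [&& I != fset0, is_interval I, I `<=` S &
      [forall J : fpowerset S,
         is_interval (val J) ==> (I `<=` val J) ==> (val J == I)]].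

Definition blocks (S : {fset int}) : {fset {fset int}} :=
  [fset I in fpowerset S | is_block S I].

Record parking_procedure := ParkingProcedure {
  parked :> seq int -> {fset int};
  parked_nil : parked [::] = fset0;
  card_parked : forall W, #|` parked W| = size W;
  parked_sub : forall W a, parked W `<=` parked (rcons W a);
  parked_free : forall W a, a \notin parked W ->
    parked (rcons W a) = a |` parked W
}.

(* [take (size W).-1 W] is W without its last letter; on a nonempty word the
   set difference is a singleton (lsP). *)
Definition ls (PP : parking_procedure) (W : seq int) : int :=
  head 0 (enum_fset (PP W `\` PP (take (size W).-1 W))).

Lemma lsP (PP : parking_procedure) (W : seq int) (a : int) :
  PP (rcons W a) `\` PP W = [fset ls PP (rcons W a)].
Proof.
rewrite /ls size_rcons /= -cats1 take_size_cat // cats1.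
have /eqP : #|` PP (rcons W a) `\` PP W| = 1%N.
  rewrite cardfsD; have /fsetIidPr -> := parked_sub PP W a.
  by rewrite !card_parked size_rcons subSnn.
case/cardfs1P => x ->; congr [fset _]; apply/esym.
have: x \in enum_fset [fset x] by apply: fset11.
have: {subset enum_fset [fset x] <= [:: x]} by move=> y; rewrite !inE.
by case: (enum_fset _) => //= y s sx _; move/(_ y (mem_head _ _)): sx; rewrite inE => /eqP.
Qed.

Definition bilateral (PP : parking_procedure) : Prop :=
  forall (W : seq int) (a t u : int),
    a \in PP W -> is_block (PP W) (zint t u) -> a \in zint t u ->
    ls PP (rcons W a) = t - 1 \/ ls PP (rcons W a) = u + 1.

Definition is_parking (PP : parking_procedure) (W : seq int) : Prop :=
  PP W = zint 1 (size W)%:Z.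

Definition car_parks_at (PP : parking_procedure) (W : seq int) (k : nat)
    (s : int) : Prop :=
  (0 < k <= size W)%N /\ ls PP (take k W) = s.

(* Cars are numbered from 1, [index] counts from 0. *)
Definition outcome (PP : parking_procedure) (W : seq int) (s : int) : nat :=
  (index s [seq ls PP (take k W) | k <- iota 1 (size W)]).+1.

(* Plane binary trees with labelled nodes; [btree unit] is the type of
   (unlabelled) binary trees. *)
Inductive btree (T : Type) : Type :=
  | Leaf
  | Node of btree T & T & btree T.
Arguments Leaf {T}.

Fixpoint tsize (T : Type) (t : btree T) : nat :=
  if t is Node l _ r then (tsize l + tsize r).+1 else 0%N.

Fixpoint tmap (T U : Type) (f : T -> U) (t : btree T) : btree U :=
  if t is Node l x r then Node (tmap f l) (f x) (tmap f r) else Leaf.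

Fixpoint inorder (T : Type) (t : btree T) : seq T :=
  if t is Node l x r then inorder l ++ x :: inorder r else [::].

(* Relabel the nodes, in in-order, by the successive entries of s. *)
Fixpoint fill (T U : Type) (x0 : U) (t : btree T) (s : seq U) : btree U :=
  if t is Node l _ r then
    Node (fill x0 l (take (tsize l) s)) (nth x0 s (tsize l))
         (fill x0 r (drop (tsize l).+1 s))
  else Leaf.

(* Nodes are addressed by their path from the root ([false] = left). *)
Fixpoint tlabel (T : Type) (t : btree T) (p : seq bool) : option T :=
  match t, p with
  | Leaf, _ => None
  | Node _ x _, [::] => Some x
  | Node l _ r, b :: p' => tlabel (if b then r else l) p'
  end.

Lemma tsize_tmap (T U : Type) (f : T -> U) t : tsize (tmap f t) = tsize t.
Proof. by elim: t => //= l -> x r ->. Qed.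

Lemma tsize_fill (T U : Type) (x0 : U) (t : btree T) s :
  tsize (fill x0 t s) = tsize t.
Proof. by elim: t s => //= l IHl x r IHr s; rewrite IHl IHr. Qed.

(* Indexed forests with node labels in T; [forest unit] is the type of
   (unlabelled) indexed forests. *)
Record forest (T : Type) := Forest {
  supp : {fset int};
  trees : {fmap {fset int} -> btree T};
  dom_trees : domf trees == blocks supp;
  size_trees : [forall I : domf trees, tsize (trees I) == #|` val I|]
}.

Section MkForest.
Variables (T : Type) (S : {fset int}) (t : {fset int} -> btree T).
Hypothesis tS : forall I, I \in blocks S -> tsize (t I) = #|` I|.

Lemma mkforest_dom : domf [fmap I : blocks S => t (val I)] == blocks S.
Proof. by []. Qed.

Lemma mkforest_size :
  [forall I : domf [fmap I : blocks S => t (val I)],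
     tsize ([fmap I : blocks S => t (val I)] I) == #|` val I|].
Proof. by apply/forallP => I; rewrite ffunE tS // (valP I). Qed.

Definition mkforest : forest T := Forest mkforest_dom mkforest_size.
End MkForest.

Definition tree_at (T : Type) (F : forest T) (I : {fset int}) : btree T :=
  odflt Leaf (trees F).[? I]%fmap.

Lemma tsize_tree_at (T : Type) (F : forest T) (I : {fset int}) :
  I \in blocks (supp F) -> tsize (tree_at F I) = #|` I|.
Proof.
rewrite -(eqP (dom_trees F)) => IF; rewrite /tree_at in_fnd /=.
exact: (eqP (forallP (size_trees F) [` IF])).
Qed.

Section ForestOps.
Variables T U : Type.

Lemma tsize_fmap_forest (f : T -> U) (F : forest T) (I : {fset int}) :
  I \in blocks (supp F) -> tsize (tmap f (tree_at F I)) = #|` I|.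
Proof. by rewrite tsize_tmap; apply: tsize_tree_at. Qed.

Definition map_forest (f : T -> U) (F : forest T) : forest U :=
  mkforest (@tsize_fmap_forest f F).

Lemma tsize_canonical (F : forest T) (I : {fset int}) :
  I \in blocks (supp F) ->
  tsize (fill 0 (tree_at F I) (sort <=%R (enum_fset I))) = #|` I|.
Proof. by rewrite tsize_fill; apply: tsize_tree_at. Qed.

Definition canonical (F : forest T) : forest int :=
  mkforest (@tsize_canonical F).
End ForestOps.

Definition forest_shape (T : Type) (F : forest T) : forest unit :=
  map_forest (fun=> tt) F.

(* A node of a forest is given by its block and its path in the tree of that
   block. *)
Definition node : Type := ({fset int} * seq bool)%type.

Definition label (T : Type) (F : forest T) (v : node) : option T :=
  tlabel (tree_at F v.1) v.2.

(* The forest with empty support counts as a tree, namely the empty one. *)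
Definition is_tree (T : Type) (F : forest T) : bool :=
  (#|` blocks (supp F)| <= 1)%N.

(* Decreasing tree of a sequence: the maximum is the root, and the entries to
   its left and right give the subtrees; n bounds the recursion depth. *)
Fixpoint dtree_rec (n : nat) (s : seq nat) : btree nat :=
  match n, s with
  | n'.+1, _ :: _ =>
    let m := (\max_(x <- s) x)%N in
    let j := index m s in
    Node (dtree_rec n' (take j s)) m (dtree_rec n' (drop j.+1 s))
  | _, _ => Leaf
  end.

Definition dtree (s : seq nat) : btree nat := dtree_rec (size s) s.

Lemma bigmax_mem (s : seq nat) : s != [::] -> (\max_(x <- s) x)%N \in s.
Proof.
elim: s => // a [|b s] IH _; first by rewrite big_seq1 inE.
rewrite big_cons; case: leqP => _; last by rewrite mem_head.
by rewrite in_cons IH ?orbT.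
Qed.

Lemma inorder_dtree (s : seq nat) : inorder (dtree s) = s.
Proof.
suff H n s' : (size s' <= n)%N -> inorder (dtree_rec n s') = s' by exact: H.
elim: n s' => [|n IH] {}s; first by rewrite leqn0 size_eq0 => /eqP ->.
case: s => [|a s] // le_sn.
set s' := a :: s in le_sn *; rewrite [dtree_rec _ _]/=.
set m := (\max_(x <- _) x)%N; set j := index m s'.
have jm : (j < size s')%N by rewrite index_mem bigmax_mem.
rewrite /= -/s' -/m -/j !IH.
- by rewrite -[X in X :: _](nth_index 0%N (bigmax_mem (isT : s' != [::]))) -drop_nth // cat_take_drop.
- by rewrite size_drop (leq_trans (leq_subr _ _)).
- by rewrite -/(index m s') size_take -/j jm -ltnS (leq_trans jm).
Qed.

Lemma size_inorder (T : Type) (t : btree T) : size (inorder t) = tsize t.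
Proof. by elim: t => //= l IHl x r IHr; rewrite size_cat /= IHl IHr addnS. Qed.

Section Correspondence.
Variables (PP : parking_procedure) (W : seq int).

Lemma tsize_Qtree (I : {fset int}) :
  I \in blocks (PP W) ->
  tsize (dtree [seq outcome PP W i | i <- sort <=%R (enum_fset I)]) = #|` I|.
Proof. by rewrite -size_inorder inorder_dtree size_map size_sort. Qed.

Definition Qforest : forest nat := mkforest tsize_Qtree.

(* The letter a_q of W is [nth 0 W q.-1]. *)
Definition Pforest : forest int :=
  map_forest (fun q => nth 0 W q.-1) Qforest.
End Correspondence.

Definition correspondence (PP : parking_procedure) (W : seq int) :
    forest int * forest nat :=
  (Pforest PP W, Qforest PP W).

(* Main.v *)
Require Import Defs.
From mathcomp Require Import all_boot all_order all_algebra finmap.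
Local Open Scope fset_scope.
Local Open Scope ring_scope.

(* In-order traversal recovers from Q the outcome function on each block, so
   every index q of a letter occurs as a label of Q, and the node that carries
   it carries the letter a_q in P. Hence W can be read off (P, Q). *)

Set Implicit Arguments.
Unset Strict Implicit.
Unset Printing Implicit Defensive.
Import Order.TTheory GRing.Theory Num.Theory.

Section Trees.
Variables T U : Type.

Lemma inorder_tmap (f : T -> U) (t : btree T) :
  inorder (tmap f t) = map f (inorder t).
Proof. by elim: t => //= l -> x r ->; rewrite map_cat. Qed.

(** [fill] cuts [s] exactly where the root of [t] cuts its in-order reading, so the node at path [p]
    receives the entry of [s] that [f] sends to its old label. With [f] the outcome function, this
    passes from labels of Q to canonical labels. *)
Lemma tlabel_fill_inorder (V : eqType) (f : V -> T) (x0 : V) (g : T -> U)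
    (t : btree T) (s : seq V) (p : seq bool) (k : T) :
  inorder t = map f s -> tlabel t p = Some k ->
  exists2 x, tlabel (fill x0 (tmap g t) s) p = Some x & x \in s /\ f x = k.
Proof.
elim: t s p => [//|l IHl y r IHr] s p /= eq_s.
have size_s : size s = (Defs.tsize l + Defs.tsize r).+1.
  by rewrite -(size_map f) -eq_s size_cat /= !size_inorder addnS.
have lt_l : (Defs.tsize l < size s)%N by rewrite size_s ltnS leq_addr.
have eq_l : inorder l = map f (take (Defs.tsize l) s).
  by rewrite map_take -eq_s -size_inorder take_size_cat.
(* The root entry is kept at the head of the dropped list, so that one equation yields both the root
   label and the right subtree. *)
have eq_r : y :: inorder r = map f (drop (Defs.tsize l) s).
  by rewrite map_drop -eq_s -size_inorder drop_size_cat.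
move: eq_r; rewrite (drop_nth x0) //= => -[eq_y eq_r].
rewrite tsize_tmap; case: p => [[<-]|b p].
  by exists (nth x0 s (Defs.tsize l)); rewrite ?mem_nth.
case: b => lab_p.
  have [x lab_x [x_s fx]] := IHr _ p eq_r lab_p.
  by exists x => //; split=> //; apply: mem_drop x_s.
have [x lab_x [x_s fx]] := IHl _ p eq_l lab_p.
by exists x => //; split=> //; apply: mem_take x_s.
Qed.

End Trees.

Lemma card_zint1 (r : nat) : #|` zint 1 r%:Z| = r.
Proof.
have -> : zint 1 r%:Z = [fset i.+1%:Z | i in iota 0 r].
  apply/fsetP => k; rewrite in_zint; apply/idP/imfsetP => [|[i /= i_r ->]].
    case: k => [[|i]|i] // ki; exists i => //=.
    by move: ki; rewrite mem_iota.
  by move: i_r; rewrite mem_iota.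
by rewrite card_imfset => [|i j [->]] //=; rewrite undup_id ?iota_uniq ?size_iota.
Qed.

Lemma is_interval1 (s : int) : is_interval [fset s].
Proof.
apply/forallP => -[i /= /[!inE] /eqP ->]; apply/forallP => -[j /= /[!inE] /eqP ->].
by apply/fsubsetP => k; rewrite in_zint inE eq_le andbC.
Qed.

Lemma in_blocksW (S I : {fset int}) : I \in blocks S -> I `<=` S.
Proof. by rewrite !inE => /andP[]; rewrite fpowersetE. Qed.

(** Among the intervals in [S] containing [s], a family that contains [[fset s]], one of largest
    cardinality is maximal for inclusion. *)
Lemma exists_block (S : {fset int}) (s : int) :
  s \in S -> exists2 I, I \in blocks S & s \in I.
Proof.
move=> sS.
have s1S : [fset s] \in fpowerset S by rewrite fpowersetE fsub1set.
pose A (J : fpowerset S) := is_interval (val J) && (s \in val J).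
have A1 : A [` s1S] by rewrite /A /= is_interval1 inE eqxx.
case: (arg_maxnP (fun J : fpowerset S => #|` val J|) A1).
move=> I /andP[intI sI] maxI; exists (val I) => //.
have IS : val I `<=` S by rewrite -fpowersetE (valP I).
rewrite !inE (valP I) /= /is_block intI IS /=.
apply/andP; split; first by apply/fset0Pn; exists s.
apply/forallP => J; apply/implyP => intJ; apply/implyP => IJ.
rewrite eq_sym eqEfcard IJ /=; apply: maxI.
by rewrite /A intJ (fsubsetP IJ).
Qed.

Lemma tree_at_mkforest (T : Type) (S : {fset int}) (t : {fset int} -> btree T)
    (tS : forall I, I \in blocks S -> Defs.tsize (t I) = #|` I|) (I : {fset int}) :
  tree_at (mkforest tS) I = if I \in blocks S then t I else Leaf.
Proof.
rewrite /tree_at /=; case: ifP => IS; first by rewrite in_fnd /= ffunE.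
by rewrite not_fnd //= IS.
Qed.

Section Outcome.
Variable PP : parking_procedure.
Implicit Type W : seq int.

(** The spots in order of arrival: entry [k], counted from 0, belongs to car [k.+1]. [outcome] is
    the position in this list, plus one. *)
Definition spots W := [seq ls PP (take k W) | k <- iota 1 (size W)].

Lemma spots_rcons W a : spots (rcons W a) = rcons (spots W) (ls PP (rcons W a)).
Proof.
rewrite /spots size_rcons -[X in iota _ X]addn1 iotaD map_cat cats1 /= add1n.
rewrite take_oversize ?size_rcons //; congr rcons; apply/eq_in_map => k.
by rewrite mem_iota add1n ltnS => /andP[_ kW]; rewrite -cats1 takel_cat.
Qed.

(** By [lsP], each new car adds exactly its own spot to the occupied set. *)
Lemma mem_spots W : spots W =i PP W.
Proof.
elim/last_ind: W => [|W a IH] s; first by rewrite parked_nil.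
rewrite spots_rcons mem_rcons in_cons IH.
rewrite -in_fset1 -lsP in_fsetD.
by case: (boolP (s \in PP W)) => [/(fsubsetP (parked_sub PP W a)) ->|]; rewrite ?orbT ?orbF.
Qed.

(** The last spot lies outside [PP W], which by [mem_spots] collects all earlier spots. *)
Lemma uniq_spots W : uniq (spots W).
Proof.
elim/last_ind: W => [//|W a IH]; rewrite spots_rcons rcons_uniq IH mem_spots andbT.
by have := fset11 (ls PP (rcons W a)); rewrite -lsP in_fsetD => /andP[].
Qed.

Lemma size_spots W : size (spots W) = size W.
Proof. by rewrite size_map size_iota. Qed.

Lemma car_parks_at_outcome W s : s \in PP W -> car_parks_at PP W (outcome PP W s) s.
Proof.
rewrite -mem_spots => sW; have := sW; rewrite -index_mem size_spots => lt_sW.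
split; first exact: lt_sW.
rewrite -[RHS](nth_index 0 sW) (nth_map 0%N) ?size_iota //.
by rewrite nth_iota // add1n.
Qed.

Lemma outcome_nth W k : (k < size W)%N -> outcome PP W (nth 0 (spots W) k) = k.+1.
Proof.
by move=> kW; rewrite /outcome -/(spots W) index_uniq ?size_spots ?uniq_spots.
Qed.

Lemma inorder_Qforest W I : I \in blocks (PP W) ->
  inorder (tree_at (Qforest PP W) I) =
  [seq outcome PP W i | i <- sort <=%R (enum_fset I)].
Proof. by move=> IW; rewrite tree_at_mkforest IW inorder_dtree. Qed.

Lemma inorder_Pforest W I : I \in blocks (PP W) ->
  inorder (tree_at (Pforest PP W) I) =
  [seq nth 0 W q.-1 | q <- inorder (tree_at (Qforest PP W) I)].
Proof. by move=> IW; rewrite tree_at_mkforest IW inorder_tmap. Qed.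

Lemma index_in_Qforest W k : (k < size W)%N ->
  exists2 I, I \in blocks (PP W) & k.+1 \in inorder (tree_at (Qforest PP W) I).
Proof.
move=> kW; have sW : nth 0 (spots W) k \in PP W.
  by rewrite -mem_spots mem_nth ?size_spots.
have [I IW sI] := exists_block sW; exists I => //.
by rewrite inorder_Qforest // -(outcome_nth kW) map_f ?mem_sort.
Qed.

Lemma correspondence_inj : injective (correspondence PP).
Proof.
move=> W W' eqWW'; have eqP := congr1 fst eqWW'; have eqQ := congr1 snd eqWW'.
rewrite /= in eqP eqQ.
have eqS : PP W = PP W' by have := congr1 (@supp _) eqQ.
(* The common support determines the number of cars. *)
have eq_size : size W = size W' by rewrite -(card_parked PP W) eqS card_parked.
apply: (@eq_from_nth _ 0) => // k kW.
have [I IW kI] := index_in_Qforest kW.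
have IW' : I \in blocks (PP W') by rewrite -eqS.
(* The same P-tree is read in two ways over one list of Q-labels, so the letter maps of [W] and [W']
   agree at every label in it, in particular at [k.+1]. *)
have := inorder_Pforest IW; rewrite eqP (inorder_Pforest IW') -eqQ.
by move/eq_in_map/(_ _ kI).
Qed.

Lemma label_canonical_Qforest W v k : label (Qforest PP W) v = Some k ->
  exists2 s, label (canonical (forest_shape (Qforest PP W))) v = Some s &
             car_parks_at PP W k s.
Proof.
case: v => I p; rewrite /label /=.
(* Outside the blocks [tree_at] returns the default [Leaf], which carries no label. *)
have [IW|IW] := boolP (I \in blocks (PP W)); last first.
  by rewrite tree_at_mkforest (negPf IW).
move=> /(tlabel_fill_inorder 0 (fun=> tt) (inorder_Qforest IW)).
move=> [s lab_s [sI <-]]; exists s.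
  by rewrite tree_at_mkforest IW tree_at_mkforest IW.
by apply: car_parks_at_outcome; rewrite (fsubsetP (in_blocksW IW)) // -(mem_sort <=%R).
Qed.

End Outcome.

Theorem proposition5p4 (PP : parking_procedure) (hPP : bilateral PP) :
  [/\ forall (W : seq int) (P : forest int) (Q : forest nat) (F : forest unit),
        correspondence PP W = (P, Q) -> forest_shape P = F -> forest_shape Q = F ->
        is_tree F -> (exists r : nat, supp F = zint 1 r%:Z) ->
        is_parking PP W,
      injective (correspondence PP) &
      forall (W : seq int) (P : forest int) (Q : forest nat)
             (v : node) (k : nat),
        correspondence PP W = (P, Q) ->
        label Q v = Some k ->
        exists2 s : int, label (canonical (forest_shape Q)) v = Some s &
                         car_parks_at PP W k s].
Proof.
split; last 1 first.
- by move=> W P Q v k [_ <-]; apply: label_canonical_Qforest.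
(* The support of the shape is [PP W]; counting its elements forces [r] to be the length of [W]. *)
- move=> W P Q F [_ <-] _ <- _ [r /= eqS].
  by rewrite /is_parking -(card_parked PP W) eqS card_zint1.
- exact: correspondence_inj.
Qed.
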